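(* Let $-\infty<a<b<+\infty$, $0<\alpha<1$, $0\le\beta\le1$, $\gamma=\alpha+\beta-\alpha\beta$, and let $c,d,e_k\in\mathbb{R}$ with $d\neq0$ and $c+d\neq0$. Let $f:(a,b]\times\mathbb{R}\to\mathbb{R}$ be a function such that $f(\cdot,z(\cdot))\in C_{1-\gamma}[a,b]$ for any $z\in C_{1-\gamma}[a,b]$. If $z\in C_{1-\gamma}^{\gamma}[a,b]$, then $z$ satisfies the boundary value problem $$D_{a^+}^{\alpha,\beta}z(t)=f(t,z(t)),\quad t\in(a,b],\qquad I_{a^+}^{1-\gamma}\big[c\,z(a^+)+d\,z(b^-)\big]=e_k,$$ if and only if $z$ satisfies, for $t\in(a,b]$, the integral equation $$z(t)=\frac{(t-a)^{\gamma-1}}{\Gamma(\gamma)}\frac{e_k}{d\left(1+\frac cd\right)}-\frac{1}{1+\frac cd}\,\frac{(t-a)^{\gamma-1}}{\Gamma(\gamma)}\,\frac{1}{\Gamma(1-\gamma+\alpha)}\int_a^b(b-s)^{\alpha-\gamma}f(s,z(s))\,ds+\frac1{\Gamma(\alpha)}\int_a^t(t-s)^{\alpha-1}f(s,z(s))\,ds.$$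
   Context: Notation. For $\mu>0$, $I_{a^+}^{\mu}g(t)=\frac1{\Gamma(\mu)}\int_a^t(t-s)^{\mu-1}g(s)\,ds$ is the left-sided Riemann–Liouville fractional integral, and $I_{a^+}^0$ is the identity. For $0\le\mu\le1$, $D_{a^+}^{\mu}g=\frac{d}{dt}I_{a^+}^{1-\mu}g$ is the Riemann–Liouville derivative. For $0<\alpha<1$, $0\le\beta\le1$, the Hilfer derivative of order $\alpha$ and type $\beta$ is $D_{a^+}^{\alpha,\beta}g=I_{a^+}^{\beta(1-\alpha)}\frac{d}{dt}I_{a^+}^{(1-\beta)(1-\alpha)}g$. With $\gamma=\alpha+\beta-\alpha\beta$ one has $(1-\beta)(1-\alpha)=1-\gamma$. Spaces. $C_{1-\gamma}[a,b]$ is the set of $g:(a,b]\to\mathbb{R}$ such that $(t-a)^{1-\gamma}g(t)$ is continuous on $[a,b]$ (i.e. extends continuously to $t=a$). $C_{1-\gamma}^{\gamma}[a,b]=\{g\in C_{1-\gamma}[a,b]: D_{a^+}^{\gamma}g\in C_{1-\gamma}[a,b]\}$. The boundary condition $I_{a^+}^{1-\gamma}[c\,z(a^+)+d\,z(b^-)]=e_k$ means $c\lim_{t\to a^+}I_{a^+}^{1-\gamma}z(t)+d\lim_{t\to b^-}I_{a^+}^{1-\gamma}z(t)=e_k$. Here $e_k$ is just a fixed real number. *)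

(* Defs.v *)
From HB Require Import structures.
From mathcomp Require Import all_boot all_order all_algebra.
From mathcomp Require Import all_classical all_reals all_analysis.
Set Implicit Arguments.
Unset Strict Implicit.
Unset Printing Implicit Defensive.
Import Order.TTheory GRing.Theory Num.Theory.
Import numFieldNormedType.Exports.
Local Open Scope classical_set_scope.
Local Open Scope ring_scope.

(* Functions on (a, b] are represented by total functions R -> R; every notion
   below depends only on their values on (a, b]. *)

Definition Gamma (R : realType) (x : R) : R :=
  \int[@lebesgue_measure R]_(t in `]0, +oo[) (t `^ (x - 1) * expR (- t)).

Definition RLint (R : realType) (a mu : R) (g : R -> R) (t : R) : R :=
  if mu == 0 then g t
  else (Gamma mu)^-1 *
    \int[@lebesgue_measure R]_(s in `]a, t[) ((t - s) `^ (mu - 1) * g s).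

(* Derivatives are taken relative to (a, b], hence from the left at b. *)
Definition diffquot (R : realType) (h : R -> R) (t x : R) : R :=
  (h x - h t) / (x - t).

Definition derivable_on (R : realType) (a b : R) (h : R -> R) : Prop :=
  forall t : R, a < t <= b ->
    exists l : R, diffquot h t x @[x --> within `]a, b] t^'] --> l.

(* Meaningful at the points of (a, b] where the limit exists. *)
Definition deriv_on (R : realType) (a b : R) (h : R -> R) (t : R) : R :=
  lim (diffquot h t x @[x --> within `]a, b] t^']).

Definition RLderiv (R : realType) (a b mu : R) (g : R -> R) : R -> R :=
  deriv_on a b (RLint a (1 - mu) g).

Definition Hilfer (R : realType) (a b alpha beta : R) (g : R -> R) : R -> R :=
  RLint a (beta * (1 - alpha))
    (deriv_on a b (RLint a ((1 - beta) * (1 - alpha)) g)).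

(* C_sigma[a, b]: (t - a)^sigma g(t) extends to a continuous function
   on [a, b]. *)
Definition Cw (R : realType) (a b sigma : R) (g : R -> R) : Prop :=
  exists2 h : R -> R, {within `[a, b], continuous h} &
    forall t : R, a < t <= b -> h t = (t - a) `^ sigma * g t.

(* C_{1-gamma}^gamma[a, b]: D^gamma g exists on (a, b] and lies in
   C_{1-gamma}[a, b]. *)
Definition Cwd (R : realType) (a b gamma : R) (g : R -> R) : Prop :=
  [/\ Cw a b (1 - gamma) g,
      derivable_on a b (RLint a (1 - gamma) g) &
      Cw a b (1 - gamma) (RLderiv a b gamma g)].

(* c lim_{t -> a+} I^{1-gamma} z(t) + d lim_{t -> b-} I^{1-gamma} z(t) = e *)
Definition boundary_condition (R : realType) (a b gamma c d e : R)
    (z : R -> R) : Prop :=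
  exists la lb : R,
    [/\ RLint a (1 - gamma) z t @[t --> a^'+] --> la,
        RLint a (1 - gamma) z t @[t --> b^'-] --> lb &
        c * la + d * lb = e].

(* Main.v *)
(* Write I^m for the Riemann-Liouville integral and delta = beta (1 - alpha), so
   gamma = alpha + delta and the Hilfer derivative of z is I^delta phi with
   phi = d/dt I^(1-gamma) z.  Everything follows from four facts on functions
   (t - a)^(-sigma) h(t), with h continuous and sigma < 1:
   - I^m I^n = I^(m+n), from Tonelli and Gamma(m) Gamma(n) = B(m, n) Gamma(m+n);
   - I^m sends the weight sigma to the weight sigma - m;
   - I^m is injective for 0 <= m <= 1 (compose with I^(1-m) and differentiate);
   - I^1 v' = v - v(a+).
   With A = lim_(t -> a+) I^(1-gamma) z, the last one gives
   I^1 phi = I^(1-gamma) z - A.  If I^delta phi = F, injectivity of I^(1-gamma)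
   yields z = A (t-a)^(gamma-1)/Gamma(gamma) + I^gamma phi, and
   I^gamma phi = I^alpha I^delta phi = I^alpha F.  Conversely this formula for z
   gives I^(1-delta) I^delta phi = I^1 phi = I^(1-delta) F, hence
   I^delta phi = F.  Evaluating I^(1-gamma) z = A + I^(1-delta) F at b turns
   the boundary condition into the value of A. *)
Require Import Defs.
From HB Require Import structures.
From mathcomp Require Import all_boot all_order all_algebra.
From mathcomp Require Import all_classical all_reals all_analysis.
From mathcomp Require Import measurable_realfun ring lra.
Set Implicit Arguments.
Unset Strict Implicit.
Unset Printing Implicit Defensive.
Import Order.TTheory GRing.Theory Num.Theory.
Import numFieldNormedType.Exports.
Local Open Scope classical_set_scope.
Local Open Scope ring_scope.

(** * Convolution of nonnegative functions *)

Section Convolution.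
Context {R : realType}.
Local Notation mu := (@lebesgue_measure R).
Local Open Scope ereal_scope.

(** The image of Lebesgue measure under x -> c x + d, scaled by c, gives each half-open interval its
    length, so uniqueness identifies it with Lebesgue measure. *)
Lemma ge0_integral_affine (c d : R) (f : R -> \bar R) : (0 < c)%R ->
  measurable_fun [set: R] f -> (forall x, 0 <= f x) ->
  \int[mu]_x f x = c%:E * \int[mu]_x f (c * x + d)%R.
Proof.
move=> c0 mf f0; pose c' := PosNum c0.
pose phi := (fun x : measurableTypeR R => (c * x + d)%R : measurableTypeR R).
have mphi : measurable_fun setT phi.
  by apply: measurable_funD => //; exact: measurable_funM.
(* [nu] is the pushforward bundled as a measure, so that it can be rescaled and compared with
   Lebesgue measure. *)
have [nu nuE] : exists nu : {measure set (measurableTypeR R) -> \bar R},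
    nu = pushforward mu phi :> (set _ -> \bar R).
  by unshelve eexists (pushforward mu phi).
rewrite -(@ge0_integral_pushforward _ _ (measurableTypeR R) (measurableTypeR R)
  R phi mphi mu setT f)// -nuE.
rewrite -(@ge0_integral_mscale _ (measurableTypeR R) R nu setT measurableT
  c'%:num%:nng%R f)//=.
apply: eq_measure_integral => A mA _.
apply: lebesgue_measure_unique => // _ [[x y]] _ <-.
transitivity (c%:E * pushforward mu phi `]x, y]); last by rewrite -nuE.
rewrite /pushforward.
have -> : phi @^-1` `]x, y] = `]((x - d) / c)%R, ((y - d) / c)%R]%classic.
  apply/seteqP; split => z /=; rewrite !in_itv/= ltr_pdivrMr// ler_pdivlMr//.
    by rewrite ltrBlDr lerBrDr (mulrC z).
  by rewrite ltrBlDr lerBrDr (mulrC z).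
rewrite !lebesgue_measure_itv/= !lte_fin ltr_pM2r ?invr_gt0// ltrD2r.
case: ifPn => // _; last by rewrite mule0.
by rewrite -!EFinD -EFinM; congr EFin; field; rewrite gt_eqF.
Qed.

(** With extended real values, Tonelli applies to nonnegative functions before any finiteness is
    known. *)
Definition conv (f g : R -> \bar R) (t : R) : \bar R :=
  \int[mu]_s (f (t - s)%R * g s).

Lemma conv_ge0 f g t : (forall x, 0 <= f x) -> (forall x, 0 <= g x) ->
  0 <= conv f g t.
Proof. by move=> f0 g0; apply: integral_ge0 => s _; exact: mule_ge0. Qed.

Lemma measurable_conv_integrand (f g : R -> \bar R) :
  measurable_fun [set: R] f -> measurable_fun [set: R] g ->
  measurable_fun [set: R * R] (fun z : R * R => f (z.1 - z.2)%R * g z.2).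
Proof.
move=> mf mg; apply: emeasurable_funM.
  apply: (measurableT_comp mf); apply: measurable_funB => //.
exact: (measurableT_comp mg).
Qed.

Lemma measurable_conv (f g : R -> \bar R) :
  measurable_fun [set: R] f -> measurable_fun [set: R] g ->
  (forall x, 0 <= f x) -> (forall x, 0 <= g x) ->
  measurable_fun [set: R] (conv f g).
Proof.
move=> mf mg f0 g0.
apply: (measurable_fun_fubini_tonelli_F (m2 := mu)
  (fun z : R * R => f (z.1 - z.2)%R * g z.2)).
  exact: measurable_conv_integrand.
by move=> x; exact: mule_ge0.
Qed.

Lemma convZr (k : R) (f g : R -> \bar R) t : (0 <= k)%R ->
  measurable_fun [set: R] f -> measurable_fun [set: R] g ->
  (forall x, 0 <= f x) -> (forall x, 0 <= g x) ->
  conv f (fun s => k%:E * g s) t = k%:E * conv f g t.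
Proof.
move=> k0 mf mg f0 g0; rewrite /conv -ge0_integralZl//.
- by apply: eq_integral => s _; rewrite muleCA.
- apply: emeasurable_funM => //.
  by apply: (measurableT_comp mf); exact: measurable_funB.
- by move=> s _; exact: mule_ge0.
Qed.

Lemma convZl (k : R) (f g : R -> \bar R) t : (0 <= k)%R ->
  measurable_fun [set: R] f -> measurable_fun [set: R] g ->
  (forall x, 0 <= f x) -> (forall x, 0 <= g x) ->
  conv (fun s => k%:E * f s) g t = k%:E * conv f g t.
Proof.
move=> k0 mf mg f0 g0; rewrite -convZr//.
by apply: eq_integral => s _; rewrite -muleA muleCA.
Qed.

(** Tonelli exchanges the two integrations; the translation s -> s + r in the inner one then
    exhibits [conv f g] at t - r. *)
Lemma conv_assoc (f g h : R -> \bar R) t :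
  measurable_fun [set: R] f -> measurable_fun [set: R] g ->
  measurable_fun [set: R] h ->
  (forall x, 0 <= f x) -> (forall x, 0 <= g x) -> (forall x, 0 <= h x) ->
  conv f (conv g h) t = conv (conv f g) h t.
Proof.
move=> mf mg mh f0 g0 h0; rewrite /conv.
have mfB c : measurable_fun [set: R] (fun s : R => f (c - s)%R).
  by apply: (measurableT_comp mf); apply: measurable_funB.
have mgB c : measurable_fun [set: R] (fun s : R => g (c - s)%R).
  by apply: (measurableT_comp mg); apply: measurable_funB.
have mgB' c : measurable_fun [set: R] (fun s : R => g (s - c)%R).
  by apply: (measurableT_comp mg); apply: measurable_funB.
transitivity (\int[mu]_s \int[mu]_r (f (t - s)%R * (g (s - r)%R * h r))).
  apply: eq_integral => s _; rewrite ge0_integralZl//.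
    by apply: emeasurable_funM => //; exact: mgB.
  by move=> r _; exact: mule_ge0.
rewrite (fubini_tonelli (m1 := mu) (m2 := mu)
  (fun z : R * R => f (t - z.1)%R * (g (z.1 - z.2)%R * h z.2)))/=; last 2 first.
- apply: emeasurable_funM; last exact: measurable_conv_integrand.
  by apply: (measurableT_comp (mfB t)).
- by move=> x; rewrite mule_ge0// mule_ge0.
apply: eq_integral => r _.
under eq_integral do rewrite muleA.
rewrite ge0_integralZr//; last 2 first.
- by apply: emeasurable_funM; [exact: mfB|exact: mgB'].
- by move=> s _; exact: mule_ge0.
congr (_ * _).
rewrite (@ge0_integral_affine 1 r)//; last 2 first.
- by apply: emeasurable_funM; [exact: mfB|exact: mgB'].
- by move=> s; exact: mule_ge0.
rewrite mul1e; apply: eq_integral => s _.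
by congr (f _ * g _); ring.
Qed.

(** Tonelli and translation invariance. This is the source of the product Gamma(m) Gamma(n) in the
    Beta formula. *)
Lemma integral_conv (f g : R -> \bar R) :
  measurable_fun [set: R] f -> measurable_fun [set: R] g ->
  (forall x, 0 <= f x) -> (forall x, 0 <= g x) ->
  \int[mu]_t conv f g t = \int[mu]_t f t * \int[mu]_t g t.
Proof.
move=> mf mg f0 g0.
have mfB c : measurable_fun [set: R] (fun s : R => f (s - c)%R).
  by apply: (measurableT_comp mf); apply: measurable_funB.
rewrite /conv (fubini_tonelli (m1 := mu) (m2 := mu)
  (fun z : R * R => f (z.1 - z.2)%R * g z.2))/=; last 2 first.
- exact: measurable_conv_integrand.
- by move=> x; exact: mule_ge0.
rewrite -ge0_integralZl//; last exact: integral_ge0.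
apply: eq_integral => s _; rewrite ge0_integralZr//; last exact: mfB.
congr (_ * _).
rewrite (@ge0_integral_affine 1 s (fun t => f (t - s)%R))// mul1e.
by apply: eq_integral => t _; rewrite mul1r addrK.
Qed.

End Convolution.

(** * The Gamma function and the Beta integral *)

Section GammaBeta.
Context {R : realType}.
Local Notation mu := (@lebesgue_measure R).
Local Open Scope ereal_scope.

(* The truncation matters: [powR] takes the value 1 at negative reals. *)
Definition rpow (nu x : R) : R := if (0 < x)%R then (x `^ (nu - 1))%R else 0%R.

Lemma rpow_ge0 nu x : (0 <= rpow nu x)%R.
Proof. by rewrite /rpow; case: ifP => // _; exact: powR_ge0. Qed.

Lemma measurable_rpow nu : measurable_fun [set: R] (rpow nu).
Proof.
apply: measurable_fun_if => //.
  exact: measurable_fun_ltr.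
by apply: measurable_funTS; exact: (measurableT_comp (measurable_powR _)).
Qed.

Lemma measurable_rpowE nu : measurable_fun [set: R] (EFin \o rpow nu).
Proof. by apply/measurable_EFinP; exact: measurable_rpow. Qed.

Lemma integral_gt0_rpow nu (f : R -> R) :
  \int[mu]_(t in `]0%R, +oo[) (t `^ (nu - 1) * f t)%:E =
  \int[mu]_t (rpow nu t * f t)%:E.
Proof.
rewrite integral_mkcond; apply: eq_integral => x _.
rewrite patchE /rpow; case: ifPn => [/set_mem|xn] /=.
  by rewrite in_itv/= andbT => ->.
rewrite ifF ?mul0r//; apply/negbTE; apply: contra xn => x0.
by rewrite inE /= in_itv/= x0.
Qed.

(** [Gamma] is [fine] of this value and would read 0 if the integral were infinite, so finiteness
    has to be established at this level. *)
Definition eGamma (nu : R) : \bar R := \int[mu]_t (rpow nu t * expR (- t))%:E.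

Lemma eGammaE nu : Gamma nu = fine (eGamma nu).
Proof. by rewrite /Gamma /Rintegral integral_gt0_rpow. Qed.

Lemma measurable_eGamma_integrand nu :
  measurable_fun [set: R] (fun t => (rpow nu t * expR (- t))%:E).
Proof.
apply/measurable_EFinP/measurable_funM; first exact: measurable_rpow.
by apply: measurableT_comp.
Qed.

(** On [1, 2] the integrand is at least e^(-2) / 2, because x^(nu-1) >= x^(-1) >= 1/2 there. *)
Lemma eGamma_gt0 (nu : R) : (0 < nu)%R -> 0 < eGamma nu.
Proof.
move=> nu0; pose c : R := (2^-1 * expR (- 2))%R.
apply: (@lt_le_trans _ _ (\int[mu]_(t in `[1%R, 2%R]) c%:E)).
  rewrite integral_cst//= lebesgue_measure_itv/= lte_fin ltr1n -EFinD -EFinM.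
  by rewrite lte_fin mulr_gt0 ?mulr_gt0 ?expR_gt0// subr_gt0 ltr1n.
rewrite /eGamma integral_mkcond; apply: ge0_le_integral => //.
- by move=> x _; apply: erestrict_ge0 => y _; rewrite lee_fin mulr_ge0 ?expR_ge0.
- by apply/(measurable_restrictT _ _).1.
- exact: measurable_eGamma_integrand.
move=> x _; rewrite patchE; case: ifPn => [/set_mem/=|_]; last first.
  by rewrite lee_fin mulr_ge0 ?rpow_ge0 ?expR_ge0.
rewrite in_itv/= => /andP[x1 x2]; rewrite lee_fin ler_pM ?expR_ge0//; last first.
  by rewrite ler_expR lerN2.
have x0 : (0 < x)%R by apply: lt_le_trans x1.
rewrite /rpow x0; apply: (@le_trans _ _ (x `^ (-1))%R).
  by rewrite powR_inv1 ?(ltW x0)// lef_pV2 ?posrE.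
by apply: ler_powR => //; lra.
Qed.

(** The antiderivative x^nu / nu bounds the integral over [1/(n+1), 1], away from the singularity;
    monotone convergence passes to (0, 1]. *)
Lemma integral_powR01_le (nu : R) : (0 < nu)%R ->
  \int[mu]_(t in `]0%R, 1%R]) (t `^ (nu - 1))%:E <= (nu^-1)%:E.
Proof.
move=> nu0.
pose F n : set R := `[(n.+1%:R^-1)%R, 1%R]%classic.
have F01 : \bigcup_n F n = `]0%R, 1%R]%classic.
  apply/seteqP; split => [x [n _]|x]; rewrite /F /= !in_itv/=.
    by move=> /andP[nx ->]; rewrite (lt_le_trans _ nx).
  move=> /andP[x0 x1]; exists (Num.truncn (x^-1)%R) => //=.
  rewrite in_itv/= x1 andbT -[leRHS]invrK lef_pV2 ?posrE ?invr_gt0//.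
  exact/ltW/truncnS_gt.
have := @ge0_nondecreasing_set_cvg_integral _ (measurableTypeR R) R F
  (fun t => (t `^ (nu - 1))%:E) mu.
rewrite F01 => cvgF.
apply: (@lee_cvg_to _ _ _ _ _ (fun=> (nu^-1)%:E) _ _ (cvgF _ _ _ _)).
- apply/nondecreasing_seqP => n; rewrite subsetEset; apply: subset_itvr.
  by rewrite bnd_simp lef_pV2 ?posrE// ler_nat.
- by move=> n; exact: measurable_itv.
- by move=> n; apply: measurable_funTS; apply/measurable_EFinP; exact: measurable_powR.
- by move=> n x _; rewrite lee_fin powR_ge0.
- exact: cvg_cst.
(* For n = 0 the interval is the single point 1, where the fundamental theorem, stated for proper
   intervals, does not apply. *)
apply: nearW => -[|n].
  by rewrite /F invr1 set_itv1 integral_set1 lee_fin invr_ge0 ltW.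
have n1 : (n.+2%:R^-1 < 1 :> R)%R by rewrite invf_lt1// ltr1n.
have n0 x : (n.+2%:R^-1 <= x -> 0 < x :> R)%R by move=> nx; rewrite (lt_le_trans _ nx).
have dP (x : R) : (0 < x)%R -> is_derive x 1%R (fun x => x `^ nu / nu)%R (x `^ (nu - 1))%R.
  move=> x0; have xI : x \in `]0%R, +oo[ by rewrite in_itv/= x0.
  have -> : (fun x => x `^ nu / nu)%R = nu^-1 \*: (powR (R:=R))^~ nu.
    by apply/funext => y /=; rewrite mulrC.
  apply: is_derive_eq.
    by apply: is_deriveZ; apply/derivableP/derivable_powR.
  by rewrite -derive1E powR_derive1// [LHS](mulKf (lt0r_neq0 nu0)).
have cP (x : R) : (0 < x)%R -> {for x, continuous (fun x => x `^ nu / nu)%R}.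
  move=> x0; apply: differentiable_continuous; apply/derivable1_diffP.
  by have [] := dP x x0.
rewrite /F (@continuous_FTC2 _ _ (fun x => x `^ nu / nu)%R)//.
- rewrite -EFinD lee_fin powR1 mul1r gerDl oppr_le0 mulr_ge0 ?powR_ge0//.
  by rewrite invr_ge0 ltW.
- apply: derivable_within_continuous => x; rewrite in_itv/= => /andP[/n0 x0 _].
  by apply: derivable_powR; rewrite in_itv/= x0.
- split => [x|/=|/=].
  + by rewrite in_itv/= => /andP[/ltW/n0 x0 _]; have [] := dP x x0.
  + by apply: cvg_at_right_filter; apply: cP.
  + by apply: cvg_at_left_filter; apply: cP.
- move=> x; rewrite in_itv/= => /andP[/ltW/n0 x0 _].
  by rewrite derive1E; have [_ ->] := dP x x0.
Qed.

(** The integrand is at most t^(nu-1) on (0, 1] and at most a multiple of the exponential density of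
    rate 1/2 beyond 1. The exponent m = nu + 1 is positive and exceeds nu - 1, so x^(nu-1) <= x^m
    for x >= 1. *)
Lemma eGamma_fin (nu : R) : (0 < nu)%R -> eGamma nu < +oo.
Proof.
move=> nu0.
pose m := (nu + 1)%R; have m0 : (0 < m)%R by rewrite /m; lra.
pose C := ((2 * m) `^ m)%R.
(* ln y < y at y = x / (2 m) gives x^m <= C e^(x/2). *)
have le_tail (x : R) : (1 <= x)%R ->
    (x `^ (nu - 1) * expR (- x) <= C * 2 * exponential_pdf 2^-1 x)%R.
  move=> x1; have x0 : (0 < x)%R by apply: lt_le_trans x1.
  rewrite exponential_pdfE ?(ltW x0)//.
  have -> : (C * 2 * (2^-1 * expR (- 2^-1 * x)) = C * expR (x / 2) * expR (- x))%R.
    rewrite -[RHS]mulrA -expRD.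
    have -> : (x / 2 - x = - 2^-1 * x)%R by field.
    by field.
  rewrite ler_pM2r ?expR_gt0//.
  apply: (@le_trans _ _ (x `^ m)%R).
    by apply: ler_powR => //; rewrite /m; lra.
  have -> : (x = (2 * m) * (x / (2 * m)))%R by field; rewrite gt_eqF.
  rewrite powRM ?divr_ge0 ?mulr_ge0 ?(ltW x0) ?(ltW m0)//.
  rewrite -/C ler_pM2l ?powR_gt0 ?mulr_gt0//.
  rewrite /powR gt_eqF ?divr_gt0 ?mulr_gt0// ler_expR.
  apply: (@le_trans _ _ (m * (x / (2 * m)))%R).
    by rewrite ler_pM2l// ltW// ln_sublinear// divr_gt0 ?mulr_gt0.
  rewrite le_eqVlt; apply/orP; left; apply/eqP; field; by rewrite gt_eqF.
apply: (@le_lt_trans _ _ (\int[mu]_t (((fun t => (t `^ (nu - 1))%:E) \_ `]0%R, 1%R]) t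
   + (C * 2)%:E * (exponential_pdf 2^-1 t)%:E))).
  apply: ge0_le_integral => //.
  - by move=> x _; rewrite lee_fin mulr_ge0 ?rpow_ge0 ?expR_ge0.
  - exact: measurable_eGamma_integrand.
  - apply: emeasurable_funD.
      apply/(measurable_restrictT _ _).1 => //.
      by apply: measurable_funTS; apply/measurable_EFinP; exact: measurable_powR.
    apply/measurable_EFinP; apply: measurable_funM => //.
    exact: measurable_exponential_pdf.
  move=> x _; rewrite patchE.
  have E0 : (0 <= C * 2 * exponential_pdf 2^-1 x)%R.
    by rewrite mulr_ge0 ?exponential_pdf_ge0// mulr_ge0 ?powR_ge0.
  case: ifPn => [/set_mem/=|xn].
    rewrite in_itv/= => /andP[x0 x1].
    rewrite -EFinM -EFinD lee_fin ler_wpDr// /rpow x0 ler_piMr ?powR_ge0//.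
    by rewrite -expR0 ler_expR oppr_le0 ltW.
  rewrite add0e -EFinM lee_fin /rpow; case: ifPn => [x0|_]; last by rewrite mul0r.
  apply: le_tail; move: xn; apply: contraR; rewrite -ltNge => x1.
  by rewrite inE/= in_itv/= x0 ltW.
rewrite ge0_integralD//; last 4 first.
- by move=> x _; apply: erestrict_ge0 => y _; rewrite lee_fin powR_ge0.
- apply/(measurable_restrictT _ _).1 => //.
  by apply: measurable_funTS; apply/measurable_EFinP; exact: measurable_powR.
- by move=> x _; rewrite mule_ge0 ?lee_fin ?exponential_pdf_ge0// mulr_ge0 ?powR_ge0.
- apply/measurable_EFinP; apply: measurable_funM => //.
  exact: measurable_exponential_pdf.
rewrite -integral_mkcond ge0_integralZl//; last 3 first.
- apply/measurable_EFinP; exact: measurable_exponential_pdf.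
- by move=> x _; rewrite lee_fin exponential_pdf_ge0.
- by rewrite lee_fin mulr_ge0 ?powR_ge0.
rewrite integral_exponential_pdf// mule1 lte_add_pinfty ?ltry//.
by rewrite (le_lt_trans (integral_powR01_le nu0))// ltry.
Qed.

Lemma Gamma_gt0 (nu : R) : (0 < nu)%R -> (0 < Gamma nu)%R.
Proof. by move=> nu0; rewrite eGammaE fine_gt0// eGamma_gt0// eGamma_fin. Qed.

Lemma eGamma_Gamma (nu : R) : (0 < nu)%R -> eGamma nu = (Gamma nu)%:E.
Proof.
by move=> nu0; rewrite eGammaE fineK// ge0_fin_numE ?eGamma_fin// ltW ?eGamma_gt0.
Qed.

(** The integrand is the exponential density of rate 1, whose total mass is 1. *)
Lemma Gamma1 : Gamma (1 : R) = 1%R.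
Proof.
rewrite eGammaE /eGamma (_ : \int[mu]_t _ = 1)// -(@integral_exponential_pdf R 1)//.
rewrite [RHS](_ : _ = \int[mu]_(t in `]0%R, +oo[) (exponential_pdf 1 t)%:E); last first.
  rewrite integral_itv_obnd_cbnd; last first.
    apply: measurable_funTS; apply/measurable_EFinP; exact: measurable_exponential_pdf.
  rewrite [RHS]integral_mkcond; apply: eq_integral => x _; rewrite patchE.
  case: ifPn => // xn; rewrite lt0_exponential_pdf// ltNge.
  by apply: contra xn => x0; rewrite inE/= in_itv/= x0.
rewrite [RHS]integral_mkcond; apply: eq_integral => x _; rewrite patchE.
case: ifPn => [/set_mem/=|xn]; rewrite /rpow.
  rewrite in_itv/= andbT => x0; rewrite x0 subrr powRr0 exponential_pdfE ?(ltW x0)//.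
  by rewrite !mul1r mulN1r.
rewrite ifF ?mul0r//; apply/negbTE; apply: contra xn => x0.
by rewrite inE/= in_itv/= x0.
Qed.

(** Euler's Beta integral: the truncations leave (1 - s)^(m-1) s^(n-1) on (0, 1) and 0 elsewhere. *)
Definition eBeta (m n : R) : \bar R := conv (EFin \o rpow m) (EFin \o rpow n) 1%R.

(** For t > 0 the substitution s -> t s extracts the power of t; for t <= 0 the two supports do not
    meet. *)
Lemma conv_rpow m n t :
  conv (EFin \o rpow m) (EFin \o rpow n) t = eBeta m n * (rpow (m + n) t)%:E.
Proof.
rewrite [in RHS]/rpow; case: ifPn => [t0|]; last first.
  rewrite -leNgt => t0; rewrite mule0; apply: integral0_eq => s _ /=.
  rewrite /rpow subr_gt0; case: ifPn => st; last by rewrite mul0e.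
  by rewrite ifF ?mule0//; apply/negbTE; rewrite -leNgt; lra.
rewrite /conv (@ge0_integral_affine _ t 0)//; last 2 first.
- apply: emeasurable_funM; last exact: measurable_rpowE.
  apply: (measurableT_comp (measurable_rpowE _)); exact: measurable_funB.
- by move=> s; rewrite mule_ge0// lee_fin rpow_ge0.
rewrite /eBeta /conv -ge0_integralZr//; last 3 first.
- apply: emeasurable_funM; last exact: measurable_rpowE.
  apply: (measurableT_comp (measurable_rpowE _)); exact: measurable_funB.
- by move=> s _; rewrite mule_ge0// lee_fin rpow_ge0.
- by rewrite lee_fin powR_ge0.
rewrite -ge0_integralZl//; last 3 first.
- apply: emeasurable_funM => //=.
    apply: (measurableT_comp (measurable_rpowE _)); apply: measurable_funB => //.
    apply: measurable_funD => //; exact: measurable_funM.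
  apply: (measurableT_comp (measurable_rpowE _)).
  by apply: measurable_funD => //; exact: measurable_funM.
- by move=> s _; rewrite mule_ge0// lee_fin rpow_ge0.
- by rewrite lee_fin ltW.
apply: eq_integral => s _; rewrite addr0 /= -!EFinM; congr EFin.
have -> : (t - t * s = t * (1 - s))%R by ring.
rewrite /rpow !pmulr_rgt0//; case: ifPn => s1; last by rewrite !(mul0r, mulr0).
case: ifPn => s0; last by rewrite !(mul0r, mulr0).
rewrite !powRM ?ltW//.
have -> : (t `^ (m + n - 1) = t * t `^ (m - 1) * t `^ (n - 1))%R.
  rewrite -{2}(powRr1 (ltW t0)) -!powRD ?(gt_eqF t0) ?implybT//.
  by congr (_ `^ _)%R; ring.
by ring.
Qed.

(** Convolve t^(m-1) e^(-t) with t^(n-1) e^(-t). The exponentials combine to e^(-t), so the total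
    integral is B(m, n) Gamma(m+n), while [integral_conv] gives Gamma(m) Gamma(n). *)
Lemma eBetaE m n : (0 < m)%R -> (0 < n)%R ->
  eBeta m n = (Gamma m * Gamma n / Gamma (m + n))%:E.
Proof.
move=> m0 n0; have mn0 : (0 < m + n)%R by rewrite addr_gt0.
have ge0 k x : 0 <= (rpow k x * expR (- x))%:E.
  by rewrite lee_fin mulr_ge0 ?rpow_ge0 ?expR_ge0.
have := @integral_conv R _ _ (measurable_eGamma_integrand m)
  (measurable_eGamma_integrand n) (ge0 m) (ge0 n).
rewrite -!/(eGamma _) !eGamma_Gamma//.
under eq_integral => t _.
  have -> : conv (fun t => (rpow m t * expR (- t))%:E)
      (fun t => (rpow n t * expR (- t))%:E) t =
      eBeta m n * (rpow (m + n) t * expR (- t))%:E.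
    rewrite EFinM muleA -conv_rpow /conv -ge0_integralZr//; first last.
    - by move=> s _; rewrite mule_ge0// lee_fin rpow_ge0.
    - apply: emeasurable_funM; last exact: measurable_rpowE.
      apply: (measurableT_comp (measurable_rpowE _)); exact: measurable_funB.
    apply: eq_integral => s _ /=; rewrite -!EFinM; congr EFin.
    have -> : expR (- t) = (expR (- (t - s)) * expR (- s))%R.
      by rewrite -expRD; congr expR; ring.
    by ring.
  over.
have B0 : 0 <= eBeta m n.
  by apply: conv_ge0 => x; rewrite lee_fin rpow_ge0.
rewrite ge0_integralZl//; last exact: measurable_eGamma_integrand.
rewrite -/(eGamma _) eGamma_Gamma//.
have := Gamma_gt0 mn0; move: (Gamma (m + n)) => G G0.
(* An infinite Beta value would contradict the finiteness of the product of the Gammas. *)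
move: B0; case: (eBeta m n) => [B| |]//= _; last by rewrite gt0_mulye// lte_fin.
by move=> /eqP; rewrite -EFinM eqe => /eqP <-; rewrite mulfK ?gt_eqF.
Qed.

End GammaBeta.

(** * Weighted continuous functions *)

Section Weighted.
Context {R : realType}.
Local Notation mu := (@lebesgue_measure R).

Lemma powRD_gt0 (x r s : R) : 0 < x -> x `^ (r + s) = x `^ r * x `^ s.
Proof. by move=> x0; rewrite powRD// (gt_eqF x0) implybT. Qed.

(** Precompose f with the projection of the line onto [a, b]; the extreme values of f on [a, b]
    bound the result. A bounded continuous factor on the whole line makes measurability and
    domination global. *)
Lemma within_continuous_extend (a b : R) (f : R -> R) : a < b ->
  {within `[a, b], continuous f} ->
  exists h : R -> R, [/\ continuous h, exists M : R, forall x, `|h x| <= M &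
    forall x, a <= x <= b -> h x = f x].
Proof.
move=> ab cf; pose clamp (x : R) := Num.max a (Num.min b x).
have clampI x : `[a, b]%classic (clamp x).
  by rewrite /= in_itv/= le_max lexx/= ge_max (ltW ab)/= ge_min lexx.
have clampK x : a <= x <= b -> clamp x = x.
  by move=> /andP[ax xb]; rewrite /clamp (min_idPr xb) (max_idPr ax).
exists (f \o clamp); split.
- move=> x; move/subspace_continuousP: cf => /(_ _ (clampI x)) cf.
  apply: cvg_trans cf; move=> P /= wP.
  have : {for x, continuous clamp}.
    by apply: continuous_max; [exact: cvg_cst|
      apply: continuous_min; [exact: cvg_cst|exact: cvg_id]].
  move=> /(_ _ wP) H.
  have {}H : \forall y \near x, clamp y \in `[a, b] -> P (f (clamp y)) := H.
  change (\forall y \near x, P (f (clamp y))).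
  by apply: filterS H => y; apply; exact: clampI.
- have [c _ fc] := EVT_max (ltW ab) cf.
  have [d _ fd] := EVT_min (ltW ab) cf.
  exists (`|f c| + `|f d|) => x /=.
  have xI : clamp x \in `[a, b] by have := clampI x.
  have := fc _ xI; have := fd _ xI.
  have := ler_norm (f c); have := ler_norm (- f d); rewrite normrN.
  have := normr_ge0 (f c); have := normr_ge0 (f d).
  by rewrite ler_norml; lra.
- by move=> x xI; rewrite /= clampK.
Qed.

Lemma Cw_repr (a b sigma : R) (g : R -> R) : a < b -> Cw a b sigma g ->
  exists h : R -> R, [/\ continuous h, exists M : R, forall x, `|h x| <= M &
    forall t, a < t <= b -> g t = (t - a) `^ (- sigma) * h t].
Proof.
move=> ab [h0 ch0 h0E].
have [h [ch hM hE]] := within_continuous_extend ab ch0.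
exists h; split => // t /andP[at_ tb].
rewrite hE ?(ltW at_)// h0E ?at_// mulrA -powRD_gt0 ?subr_gt0//.
by rewrite addNr powRr0 mul1r.
Qed.

Lemma Cw_of (a b sigma : R) (g h : R -> R) : continuous h ->
  (forall t, a < t <= b -> g t = (t - a) `^ (- sigma) * h t) ->
  Cw a b sigma g.
Proof.
move=> ch gE; exists h; first exact: continuous_subspaceT.
move=> t tI; case/andP: (tI) => at_ _.
by rewrite gE// mulrA -powRD_gt0 ?subr_gt0// subrr powRr0 mul1r.
Qed.

Lemma eq_Cw (a b sigma : R) (g1 g2 : R -> R) :
  (forall t, a < t <= b -> g1 t = g2 t) -> Cw a b sigma g1 -> Cw a b sigma g2.
Proof. by move=> g12 [h ch hE]; exists h => // t tI; rewrite -g12// hE. Qed.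

Lemma Cw_lin (a b sigma k : R) (g1 g2 : R -> R) : a < b ->
  Cw a b sigma g1 -> Cw a b sigma g2 ->
  Cw a b sigma (fun t => g1 t + k * g2 t).
Proof.
move=> ab [h1 ch1 h1E] [h2 ch2 h2E]; exists (fun t => h1 t + k * h2 t).
  move=> t; apply: cvgD; first exact: ch1.
  by apply: cvgM; [exact: cvg_cst|exact: ch2].
by move=> t tI; rewrite h1E// h2E//; ring.
Qed.

Lemma continuous_powRB (a rho t : R) : a < t ->
  {for t, continuous (fun x => (x - a) `^ rho)}.
Proof.
move=> at_; have t0 : 0 < t - a by rewrite subr_gt0.
apply: (@continuous_comp _ _ _ (fun x => x - a) (fun x => x `^ rho)).
  by apply: cvgB; [exact: cvg_id|exact: cvg_cst].
apply: differentiable_continuous; apply/derivable1_diffP.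
by apply: derivable_powR; rewrite in_itv/= t0.
Qed.

Lemma within_continuous_powRB (a b rho : R) : a < b -> 0 <= rho ->
  {within `[a, b], continuous (fun t => (t - a) `^ rho)}.
Proof.
(* For rho = 0 the function is the constant 1, also at t = a, where 0^0 = 1. *)
move=> ab; rewrite le_eqVlt => /predU1P[<-|rho0].
  apply: continuous_subspaceT => x.
  under eq_fun do rewrite powRr0; exact: cvg_cst.
apply/continuous_within_itvP => //; split.
- by move=> x; rewrite in_itv/= => /andP[ax _]; exact: continuous_powRB.
- rewrite subrr powR0 ?gt_eqF//.
  move=> P /(powR_cvg0 rho0) H; apply/nbhs_right0P.
  have {}H : \forall e \near 0^'+, P (e `^ rho) := H.
  change (\forall e \near 0^'+, P ((a + e - a) `^ rho)).
  by apply: filterS H => e; rewrite addrAC subrr add0r.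
- by apply: cvg_at_left_filter; exact: continuous_powRB.
Qed.

Lemma Cw_le (a b sigma sigma' : R) (g : R -> R) : a < b ->
  sigma <= sigma' -> Cw a b sigma g -> Cw a b sigma' g.
Proof.
move=> ab ss' [h ch hE]; exists (fun t => (t - a) `^ (sigma' - sigma) * h t).
  move=> t; apply: cvgM; last exact: ch.
  by apply: within_continuous_powRB; rewrite ?subr_ge0.
move=> t tI; case/andP: (tI) => at_ _.
by rewrite hE// mulrA -powRD_gt0 ?subr_gt0// subrK.
Qed.

(** Here (t - a)^(-sigma) is a positive power times a bounded factor. This makes the integral terms
    vanish at a. *)
Lemma Cw_cvg0 (a b sigma : R) (g : R -> R) : a < b -> sigma < 0 ->
  Cw a b sigma g -> g t @[t --> a^'+] --> 0.
Proof.
move=> ab s0 /(Cw_repr ab)[h [ch _ gE]].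
have := @within_continuous_powRB a b (- sigma) ab.
rewrite oppr_ge0 => /(_ (ltW s0))/(continuous_within_itvP _ ab)[_ pa _].
have ha : h t @[t --> a^'+] --> h a by apply: cvg_at_right_filter; exact: ch.
have : (t - a) `^ (- sigma) * h t @[t --> a^'+] --> 0.
  have -> : 0 = (a - a) `^ (- sigma) * h a.
    by rewrite subrr powR0 ?mul0r// oppr_eq0 lt_eqF.
  exact: cvgM.
apply: cvg_trans; apply: near_eq_cvg; near=> t.
rewrite /= gE//; apply/andP; split; first by near: t; exact: nbhs_right_gt.
by near: t; exact: nbhs_right_le.
Unshelve. all: by end_near. Qed.

Lemma Cw_continuous (a b sigma x : R) (g : R -> R) : a < b -> a < x ->
  Cw a b sigma g -> {within `[x, b], continuous g}.
Proof.
move=> ab ax /(Cw_repr ab)[h [ch _ gE]].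
apply: (@subspace_eq_continuous _ _ _ (fun t => (t - a) `^ (- sigma) * h t)).
  move=> t /set_mem/=; rewrite in_itv/= => /andP[xt tb].
  by apply: esym; apply: gE; rewrite tb (lt_le_trans ax).
apply/subspace_continuousP => t; rewrite /= in_itv/= => /andP[xt _].
apply: cvg_within_filter; apply: cvgM; last exact: ch.
by apply: continuous_powRB; exact: lt_le_trans xt.
Qed.

Lemma integral_affine (c d : R) (f : R -> \bar R) : 0 < c ->
  measurable_fun [set: R] f ->
  (\int[mu]_x f x = c%:E * \int[mu]_x f (c * x + d)%R)%E.
Proof.
move=> c0 mf; rewrite integralE [in RHS]integralE.
rewrite (@ge0_integral_affine _ c d f^\+%E)//; last exact: measurable_funepos.
rewrite (@ge0_integral_affine _ c d f^\-%E)//; last exact: measurable_funeneg.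
transitivity (c%:E * (\int[mu]_x f^\+ (c * x + d)%R -
  \int[mu]_x f^\- (c * x + d)%R))%E; last first.
  by congr (_ * (_ - _))%E; apply: eq_integral => x _;
    rewrite ?funeposE ?funenegE.
(* Multiplication by c > 0 commutes with the difference of the two parts in every case, oo - oo
   included. *)
move: (integral _ _ _) (integral _ _ _) => [r| |] [s| |] //=;
  rewrite ?gt0_muley ?gt0_muleNy ?lte_fin//=.
by rewrite -?EFinD -?EFinM -?EFinD; congr EFin; ring.
Qed.

Lemma Rintegral_affine (c d : R) (f : R -> R) : 0 < c ->
  measurable_fun [set: R] f ->
  \int[mu]_x f x = c * \int[mu]_x f (c * x + d).
Proof.
move=> c0 mf; rewrite /Rintegral (@integral_affine c d)//; last exact/measurable_EFinP.
move: (integral _ _ _) => A.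
move: A => [r| |] //=; by rewrite ?gt0_muley ?gt0_muleNy ?lte_fin//= mulr0.
Qed.

End Weighted.

(** * The Riemann-Liouville integral *)

Section RL.
Context {R : realType}.
Local Notation mu := (@lebesgue_measure R).

(** The weighted function (s - a)^(-sigma) h(s), extended by 0 to the left of a, so that integrals
    over (a, t) become convolutions on the whole line. *)
Definition wpow (a sigma : R) (h : R -> R) (s : R) : R :=
  rpow (1 - sigma) (s - a) * h s.

Lemma measurable_wpow (a sigma : R) (h : R -> R) : continuous h ->
  measurable_fun [set: R] (wpow a sigma h).
Proof.
move=> ch; apply: measurable_funM; last exact: continuous_measurable_fun.
by apply: (measurableT_comp (measurable_rpow _)); exact: measurable_funB.
Qed.

Lemma wpow_ge0 (a sigma : R) (h : R -> R) s : (forall x, 0 <= h x) ->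
  0 <= wpow a sigma h s.
Proof. by move=> h0; rewrite mulr_ge0// rpow_ge0. Qed.

Lemma wpowE (a sigma : R) (h : R -> R) s : a < s ->
  wpow a sigma h s = (s - a) `^ (- sigma) * h s.
Proof.
move=> as_; rewrite /wpow /rpow subr_gt0 as_; congr (_ `^ _ * _); ring.
Qed.

Lemma wpow_eq0 (a sigma : R) (h : R -> R) s : s <= a -> wpow a sigma h s = 0.
Proof. by move=> sa; rewrite /wpow /rpow subr_gt0 ltNge sa mul0r. Qed.

Lemma conv_shift (a t : R) (f g : R -> \bar R) :
  measurable_fun [set: R] f -> measurable_fun [set: R] g ->
  (forall x, 0 <= f x)%E -> (forall x, 0 <= g x)%E ->
  conv f (fun s => g (s - a)) t = conv f g (t - a).
Proof.
move=> mf mg f0 g0; rewrite /conv.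
rewrite (@ge0_integral_affine _ 1 a (fun s => f (t - s)%R * g (s - a)%R)%E)//.
- rewrite mul1e; apply: eq_integral => s _.
  by congr (f _ * g _)%E; ring.
- apply: emeasurable_funM.
    by apply: (measurableT_comp mf); exact: measurable_funB.
  by apply: (measurableT_comp mg); exact: measurable_funB.
- by move=> x; exact: mule_ge0.
Qed.

Lemma conv_rpow_shift (m n a t : R) : 0 < m -> 0 < n ->
  conv (EFin \o rpow m) (fun s => (rpow n (s - a))%:E) t =
  (Gamma m * Gamma n / Gamma (m + n) * rpow (m + n) (t - a))%:E.
Proof.
move=> m0 n0; rewrite (@conv_shift a t (EFin \o rpow m) (EFin \o rpow n)).
- by rewrite conv_rpow eBetaE.
- exact: measurable_rpowE.
- exact: measurable_rpowE.
- by move=> x; rewrite lee_fin rpow_ge0.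
- by move=> x; rewrite lee_fin rpow_ge0.
Qed.

Lemma measurable_rpow_wpow (m sigma a t : R) (h : R -> R) : continuous h ->
  measurable_fun [set: R] (fun s => rpow m (t - s) * wpow a sigma h s).
Proof.
move=> ch; apply: measurable_funM; last exact: measurable_wpow.
by apply: (measurableT_comp (measurable_rpow _)); exact: measurable_funB.
Qed.

(** Bounding h by M leaves a translated Beta integral, finite since both m and 1 - sigma are
    positive. *)
Lemma integrable_rpow_wpow (m sigma a t M : R) (h : R -> R) :
  0 < m -> sigma < 1 -> continuous h -> (forall x, `|h x| <= M) ->
  mu.-integrable [set: R]
    (EFin \o (fun s => rpow m (t - s) * wpow a sigma h s)).
Proof.
move=> m0 s1 ch hM.
have M0 : 0 <= M by rewrite (le_trans _ (hM 0)).
apply/integrableP; split.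
  by apply/measurable_EFinP; exact: measurable_rpow_wpow.
have s0 : 0 < 1 - sigma by lra.
have mr : measurable_fun [set: R]
    (fun s => rpow m (t - s) * rpow (1 - sigma) (s - a)).
  have := @measurable_rpow_wpow m sigma a t (fun=> 1) (@cst_continuous R R 1).
  by under eq_fun do rewrite /wpow mulr1.
apply: (@le_lt_trans _ _
  (\int[mu]_s ((rpow m (t - s) * rpow (1 - sigma) (s - a))%:E * M%:E))%E).
  apply: ge0_le_integral => //.
  - apply: measurableT_comp => //.
    by apply/measurable_EFinP; exact: measurable_rpow_wpow.
  - apply: emeasurable_funM => //.
    exact/measurable_EFinP.
  move=> s _ /=; rewrite -EFinM lee_fin /wpow normrM (ger0_norm (rpow_ge0 _ _)).
  rewrite normrM (ger0_norm (rpow_ge0 _ _)) mulrA ler_wpM2l//.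
  by rewrite mulr_ge0 ?rpow_ge0.
rewrite ge0_integralZr//.
- have -> : (\int[mu]_s (rpow m (t - s) * rpow (1 - sigma) (s - a))%:E)%E =
    conv (EFin \o rpow m) (fun s => (rpow (1 - sigma) (s - a))%:E) t.
    by apply: eq_integral => s _; rewrite EFinM.
  by rewrite conv_rpow_shift// -EFinM ltry.
- exact/measurable_EFinP.
- by move=> s _; rewrite lee_fin mulr_ge0 ?rpow_ge0.
Qed.

(** The truncation of [rpow] cuts off s >= t and the vanishing of f cuts off s <= a; together they
    replace the restriction to (a, t). *)
Lemma patch_RL (m a t : R) (g f : R -> R) :
  (forall s, a < s < t -> g s = f s) -> (forall s, s <= a -> f s = 0) ->
  (fun s => (t - s) `^ (m - 1) * g s) \_ `]a, t[ =
  (fun s => rpow m (t - s) * f s).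
Proof.
move=> gf f0; apply/funext => s; rewrite patchE.
case: ifPn => [/set_mem/=|].
  rewrite in_itv/= => /andP[as_ st].
  by rewrite /rpow subr_gt0 st gf// as_.
move=> sN; have [as_|sa] := ltP a s; last by rewrite f0// mulr0.
rewrite /rpow subr_gt0 ifF ?mul0r//; apply: contraNF sN => st.
by rewrite inE/= in_itv/= as_.
Qed.

Lemma RLintE (m a t : R) (g f : R -> R) : m != 0 ->
  (forall s, a < s < t -> g s = f s) -> (forall s, s <= a -> f s = 0) ->
  RLint a m g t = (Gamma m)^-1 * \int[mu]_s (rpow m (t - s) * f s).
Proof.
move=> m0 gf f0; rewrite /RLint (negbTE m0); congr (_ * _).
by rewrite Rintegral_mkcond (patch_RL _ gf).
Qed.

Lemma eq_RLint (a b m t : R) (g1 g2 : R -> R) :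
  (forall s, a < s <= b -> g1 s = g2 s) -> a < t <= b ->
  RLint a m g1 t = RLint a m g2 t.
Proof.
move=> g12 /andP[at_ tb]; rewrite /RLint; case: ifP => _.
  by rewrite g12// at_.
congr (_ * _); apply: eq_Rintegral => s /set_mem/=; rewrite in_itv/= => /andP[as_ st].
by rewrite g12// as_ (le_trans (ltW st)).
Qed.

Lemma integrable_RL (a b sigma m t : R) (g : R -> R) : a < b -> 0 < m ->
  sigma < 1 -> Cw a b sigma g -> a < t <= b ->
  mu.-integrable `]a, t[ (EFin \o (fun s => (t - s) `^ (m - 1) * g s)).
Proof.
move=> ab m0 s1 /(Cw_repr ab)[h [ch [M hM] gE]] /andP[at_ tb].
have := @integrable_rpow_wpow m sigma a t M h m0 s1 ch hM.
rewrite -(@patch_RL m a t g (wpow a sigma h)); last 2 first.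
- move=> s /andP[as_ st].
  by rewrite gE ?wpowE// as_ (le_trans (ltW st)).
- by move=> s; exact: wpow_eq0.
rewrite -restrict_EFin => /integrable_restrict.
by rewrite setTI; apply.
Qed.

Lemma RLint_lin (a b sigma m k t : R) (g1 g2 : R -> R) : a < b -> 0 <= m ->
  sigma < 1 -> Cw a b sigma g1 -> Cw a b sigma g2 -> a < t <= b ->
  RLint a m (fun s => g1 s + k * g2 s) t = RLint a m g1 t + k * RLint a m g2 t.
Proof.
move=> ab m0 s1 C1 C2 tI; rewrite /RLint; case: eqP => [//|/eqP mN0].
have {mN0}m0 : 0 < m by rewrite lt_neqAle eq_sym mN0.
have I1 := integrable_RL ab m0 s1 C1 tI.
have I2 := integrable_RL ab m0 s1 C2 tI.
transitivity ((Gamma m)^-1 * \int[mu]_(s in `]a, t[)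
  ((t - s) `^ (m - 1) * g1 s + k * ((t - s) `^ (m - 1) * g2 s))).
  by congr (_ * _); apply: eq_Rintegral => s _; ring.
rewrite RintegralD//; last first.
  have := @integrableZl _ (measurableTypeR R) R mu `]a, t[ (measurable_itv _) k _ I2.
  by apply: eq_integrable => // s _; rewrite /= EFinM.
by rewrite RintegralZl//; ring.
Qed.

Lemma RLint_cst0 (a m t : R) : RLint a m (fun=> 0) t = 0.
Proof.
rewrite /RLint; case: ifP => // _.
rewrite (_ : \int[mu]_(s in _) _ = 0) ?mulr0//.
under eq_Rintegral do rewrite mulr0.
by rewrite Rintegral_cst//= mul0r.
Qed.

(* Substituting s = a + (t - a) r makes the domain of integration independent of
   t, so that dominated convergence applies. *)
Lemma Cw_RLint (a b sigma m : R) (g : R -> R) : a < b -> 0 <= m ->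
  sigma < 1 -> Cw a b sigma g -> Cw a b (sigma - m) (RLint a m g).
Proof.
move=> ab; rewrite le_eqVlt => /predU1P[<- _|m0 s1].
  by rewrite subr0; apply: eq_Cw => t _; rewrite /RLint eqxx.
move=> /(Cw_repr ab)[h [ch [M hM] gE]].
have M0 : 0 <= M by rewrite (le_trans _ (hM 0)).
(* The Beta kernel on (0, 1); its multiple [k r * M] dominates every [F t], uniformly in t. *)
pose k r := rpow m (1 - r) * rpow (1 - sigma) r.
pose F (t r : R) := k r * h ((t - a) * r + a).
have mk : measurable_fun [set: R] k.
  apply: measurable_funM; last exact: measurable_rpow.
  by apply: (measurableT_comp (measurable_rpow _)); exact: measurable_funB.
have k0 r : 0 <= k r by rewrite mulr_ge0 ?rpow_ge0.
have ik : mu.-integrable [set: R] (EFin \o (fun r => k r * M)).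
  have := @integrable_rpow_wpow m sigma 0 1 M (fun=> M) m0 s1 (@cst_continuous R R M).
  rewrite ger0_norm// => /(_ (fun=> lexx _)); apply: eq_integrable => // r _ /=.
  by rewrite /wpow subr0 mulrA.
have mF t : measurable_fun [set: R] (F t).
  apply: measurable_funM => //; apply: measurableT_comp.
    exact: continuous_measurable_fun.
  by apply: measurable_funD => //; exact: measurable_funM.
have FM t r : `|F t r| <= k r * M.
  by rewrite normrM (ger0_norm (k0 _)) ler_wpM2l.
have iF x : mu.-integrable [set: R] (EFin \o F x).
  apply: (le_integrable measurableT _ _ ik).
    by apply/measurable_EFinP; exact: mF.
  by move=> r _ /=; rewrite lee_fin (ger0_norm (mulr_ge0 (k0 r) M0)).
pose H t := \int[mu]_r F t r.
apply: (@Cw_of _ a b (sigma - m) _ (fun t => (Gamma m)^-1 * H t)).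
  move=> t; apply: cvgM; first exact: cvg_cst.
  (* The domination holds for all t, so an arbitrary open interval around t serves. *)
  apply: (@continuity_under_integral R _ _ mu F setT measurableT (t - 1) (t + 1)
    _ _ (fun r => k r * M) ik).
  - by move=> x _; exact: iF.
  - apply: aeW => r _ x _; apply: cvgM; first exact: cvg_cst.
    apply: (@continuous_comp _ _ _ (fun t => (t - a) * r + a) h); last exact: ch.
    apply: cvgD; last exact: cvg_cst.
    apply: cvgM; last exact: cvg_cst.
    by apply: cvgB; [exact: cvg_id|exact: cvg_cst].
  - by move=> x _; apply: aeW => r _; exact: FM.
  - by apply/mem_set; rewrite /= in_itv/=; apply/andP; split; lra.
move=> t /andP[at_ tb]; have t0 : 0 < t - a by rewrite subr_gt0.
rewrite (@RLintE m a t g (wpow a sigma h)) ?gt_eqF//; last 2 first.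
- move=> s /andP[as_ st].
  by rewrite gE ?wpowE// as_ (le_trans (ltW st)).
- by move=> s; exact: wpow_eq0.
rewrite [RHS]mulrCA; congr (_ * _).
rewrite (@Rintegral_affine _ (t - a) a)//; last exact: measurable_rpow_wpow.
(* Times the Jacobian t - a, this is (t - a)^(m - sigma), which gives the weight sigma - m. *)
pose c := (t - a) `^ (m - 1) * (t - a) `^ (- sigma).
rewrite (@eq_Rintegral _ _ _ mu setT (fun r => c * F t r)); last first.
  move=> r _; rewrite /F /k /wpow /c.
  have -> : t - ((t - a) * r + a) = (t - a) * (1 - r) by ring.
  have -> : (t - a) * r + a - a = (t - a) * r by ring.
  rewrite /rpow !pmulr_rgt0//; case: ifPn => r1; last by rewrite !(mul0r, mulr0).
  case: ifPn => r0; last by rewrite !(mul0r, mulr0).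
  rewrite !powRM ?(ltW t0) ?(ltW r0) ?(ltW r1)//.
  have -> : 1 - sigma - 1 = - sigma by ring.
  by rewrite mulrA mulrACA !mulrA.
rewrite RintegralZl//.
rewrite mulrA /c mulrA -{1}(powRr1 (ltW t0)) -!powRD_gt0//.
by congr (_ `^ _ * _); ring.
Qed.

Lemma EFin_Rintegral_conv (a sigma m M s : R) (h : R -> R) :
  0 < m -> sigma < 1 -> continuous h -> (forall x, `|h x| <= M) ->
  conv (EFin \o rpow m) (EFin \o wpow a sigma h) s =
  (\int[mu]_r (rpow m (s - r) * wpow a sigma h r))%:E.
Proof.
move=> m0 s1 ch hM; rewrite /Rintegral fineK.
  by apply: eq_integral => r _; rewrite EFinM.
by apply: integrable_fin_num => //; exact: integrable_rpow_wpow hM.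
Qed.

(** By associativity the iterated convolution has kernel [rpow m] convolved with [rpow n], that is
    B(m, n) [rpow (m + n)], and the Gamma factors cancel. The sign of h is what allows Tonelli. *)
Lemma RLint_RLint_ge0 (a b sigma m n M t : R) (g h : R -> R) :
  0 < m -> 0 < n -> sigma < 1 -> continuous h -> (forall x, `|h x| <= M) ->
  (forall x, 0 <= h x) -> (forall s, a < s <= b -> g s = wpow a sigma h s) ->
  a < t <= b ->
  RLint a m (RLint a n g) t = RLint a (m + n) g t.
Proof.
move=> m0 n0 s1 ch hM h0 gE /andP[at_ tb].
have mn0 : 0 < m + n by rewrite addr_gt0.
pose K p s := \int[mu]_r (rpow p (s - r) * wpow a sigma h r).
have KE p s : 0 < p -> conv (EFin \o rpow p) (EFin \o wpow a sigma h) s = (K p s)%:E.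
  by move=> p0; rewrite (@EFin_Rintegral_conv a sigma p M).
have RLK p s : 0 < p -> a < s <= b -> RLint a p g s = (Gamma p)^-1 * K p s.
  move=> p0 /andP[as_ sb]; apply: RLintE; rewrite ?gt_eqF//.
    by move=> r /andP[ar rs]; rewrite gE// ar (le_trans (ltW rs)).
  by move=> r; exact: wpow_eq0.
(* The inner integral vanishes to the left of a, so the outer one also extends to the whole line. *)
have K0 s : s <= a -> K n s = 0.
  move=> sa; rewrite /K (_ : (fun r => _) = cst 0) ?Rintegral_cst ?mul0r//.
  apply/funext => r; have [ar|ra] := ltP a r; last by rewrite wpow_eq0// mulr0.
  by rewrite /rpow subr_gt0 ltNge (le_trans sa (ltW ar)) mul0r.
have Kge0 s : 0 <= K n s.
  by apply: Rintegral_ge0 => r _; rewrite mulr_ge0 ?rpow_ge0 ?wpow_ge0.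
have mK : measurable_fun [set: R] (fun s => (K n s)%:E).
  under eq_fun do rewrite -(KE _ _ n0).
  apply: measurable_conv; first exact: measurable_rpowE.
  - by apply/measurable_EFinP; exact: measurable_wpow.
  - by move=> x; rewrite lee_fin rpow_ge0.
  - by move=> x; rewrite lee_fin wpow_ge0.
rewrite (@RLintE m a t (RLint a n g) (fun s => (Gamma n)^-1 * K n s)); last 3 first.
- by rewrite gt_eqF.
- by move=> s /andP[as_ st]; rewrite RLK// as_ (le_trans (ltW st)).
- by move=> s sa; rewrite K0// mulr0.
rewrite RLK ?at_//.
have Gm := Gamma_gt0 m0; have Gn := Gamma_gt0 n0; have Gmn := Gamma_gt0 mn0.
suff -> : \int[mu]_s (rpow m (t - s) * ((Gamma n)^-1 * K n s)) =
    (Gamma n)^-1 * (Gamma m * Gamma n / Gamma (m + n) * K (m + n) t).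
  move: (Gamma m) (Gamma n) (Gamma (m + n)) (K (m + n) t) Gm Gn Gmn => x y z w.
  by clear=> x0 y0 z0; field; rewrite !gt_eqF.
rewrite /Rintegral -[RHS]/(fine (_%:E)); congr fine.
have KEt := KE _ t mn0.
have B0 : 0 <= Gamma m * Gamma n / Gamma (m + n) :=
  divr_ge0 (mulr_ge0 (ltW Gm) (ltW Gn)) (ltW Gmn).
have Gn0 : 0 <= (Gamma n)^-1 by rewrite invr_ge0 (ltW Gn).
transitivity ((Gamma n)^-1%:E * ((Gamma m * Gamma n / Gamma (m + n))%:E *
    conv (EFin \o rpow (m + n)) (EFin \o wpow a sigma h) t))%E; last first.
  by rewrite KEt -!EFinM.
have convE : conv (EFin \o rpow n) (EFin \o wpow a sigma h) = fun s => (K n s)%:E.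
  by apply/funext => s; exact: KE.
have mw : measurable_fun [set: R] (EFin \o wpow a sigma h).
  by apply/measurable_EFinP; exact: measurable_wpow.
have w0 s : (0 <= (EFin \o wpow a sigma h) s)%E by rewrite lee_fin wpow_ge0.
have r0 p s : (0 <= (EFin \o @rpow R p) s)%E by rewrite lee_fin rpow_ge0.
have mr p : measurable_fun [set: R] (EFin \o @rpow R p) := measurable_rpowE p.
transitivity (conv (EFin \o rpow m) (fun s => (Gamma n)^-1%:E * (K n s)%:E)%E t).
  by apply: eq_integral => s _; rewrite -!EFinM.
rewrite convZr//.
congr (_ * _)%E; rewrite -convE conv_assoc// -convZl//.
congr (conv _ _ t); apply/funext => s.
by rewrite conv_rpow eBetaE.
Qed.

Lemma RLint_RLint (a b sigma m n t : R) (g : R -> R) : a < b ->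
  0 <= m -> 0 <= n -> sigma < 1 -> Cw a b sigma g -> a < t <= b ->
  RLint a m (RLint a n g) t = RLint a (m + n) g t.
Proof.
move=> ab; rewrite le_eqVlt => /predU1P[<- *|m0].
  by rewrite add0r /RLint eqxx.
rewrite le_eqVlt => /predU1P[<- *|n0].
  by rewrite addr0; congr RLint; apply/funext => s; rewrite /RLint eqxx.
move=> s1 Cg tI; have [h [ch [M hM] gE]] := Cw_repr ab Cg.
have M0 : 0 <= M by rewrite (le_trans _ (hM 0)).
(* Reduction to h >= 0: h = (h + M) - M. *)
pose h1 x := h x + M.
pose g1 := wpow a sigma h1; pose g2 := wpow a sigma (fun=> M).
have ch1 : continuous h1.
  by move=> x; apply: cvgD; [exact: ch|exact: cvg_cst].
have cM : continuous (fun _ : R => M) by exact: cst_continuous.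
have g12 s : a < s <= b -> g s = g1 s + (-1) * g2 s.
  move=> sI; case/andP: (sI) => as_ _; rewrite gE// /g1 /g2 !wpowE// /h1; ring.
have C1 : Cw a b sigma g1.
  by apply: (Cw_of ch1) => s /andP[as_ _]; rewrite /g1 wpowE.
have C2 : Cw a b sigma g2.
  by apply: (Cw_of cM) => s /andP[as_ _]; rewrite /g2 wpowE.
have E1 : RLint a m (RLint a n g1) t = RLint a (m + n) g1 t.
  apply: (@RLint_RLint_ge0 a b sigma m n (M + M) t g1 h1) => //.
    by move=> x; rewrite (le_trans (ler_normD _ _))// lerD// ger0_norm.
  by move=> x; have := hM x; rewrite ler_norml /h1; lra.
have E2 : RLint a m (RLint a n g2) t = RLint a (m + n) g2 t.
  by apply: (@RLint_RLint_ge0 a b sigma m n M t g2 (fun=> M)) => // x; rewrite ger0_norm.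
rewrite (@eq_RLint a b (m + n) t _ _ g12 tI).
rewrite (@RLint_lin a b sigma)// ?addr_ge0 ?(ltW m0) ?(ltW n0)//.
(* The inner integrals have weight sigma - n, so linearity applies to the outer integral as well. *)
have sn1 : sigma - n < 1 by rewrite ltrBlDr (lt_le_trans s1)// lerDl ltW.
rewrite -E1 -E2 -(@RLint_lin a b (sigma - n) m)//.
- apply: (@eq_RLint a b) => // s sI.
  rewrite (@eq_RLint a b n s _ _ g12 sI) (@RLint_lin a b sigma)//; exact: ltW.
- exact: ltW.
- by apply: Cw_RLint => //; exact: ltW.
- by apply: Cw_RLint => //; exact: ltW.
Qed.

Lemma RLint_powR (a m n t : R) : 0 <= m -> 0 < n -> a < t ->
  RLint a m (fun s => (s - a) `^ (n - 1) / Gamma n) t =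
  (t - a) `^ (m + n - 1) / Gamma (m + n).
Proof.
rewrite le_eqVlt => /predU1P[<- n0 _|m0 n0 at_].
  by rewrite /RLint eqxx add0r.
have mn0 : 0 < m + n by rewrite addr_gt0.
rewrite (@RLintE m a t _ (fun s => rpow n (s - a) / Gamma n)).
- have Gm := Gamma_gt0 m0; have Gn := Gamma_gt0 n0; have Gmn := Gamma_gt0 mn0.
  suff -> : \int[mu]_s (rpow m (t - s) * (rpow n (s - a) / Gamma n)) =
      (Gamma n)^-1 * (Gamma m * Gamma n / Gamma (m + n) * rpow (m + n) (t - a)).
    rewrite /rpow subr_gt0 at_;
    move: (Gamma m) (Gamma n) (Gamma (m + n)) Gm Gn Gmn (_ `^ _).
    by clear=> x y z x0 y0 z0 w; field; rewrite !gt_eqF.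
  rewrite /Rintegral -[RHS]/(fine (_%:E)); congr fine.
  rewrite EFinM -conv_rpow_shift// /conv -ge0_integralZl//.
  + by apply: eq_integral => s _; rewrite -!EFinM; congr EFin; ring.
  + apply: emeasurable_funM; apply/measurable_EFinP;
    by apply: (measurableT_comp (measurable_rpow _)); exact: measurable_funB.
  + by move=> s _; rewrite mule_ge0// lee_fin ?rpow_ge0.
  + by rewrite lee_fin invr_ge0 (ltW Gn).
- by rewrite gt_eqF.
- by move=> s /andP[as_ _]; rewrite /rpow subr_gt0 as_.
- by move=> s sa; rewrite /rpow subr_gt0 ltNge sa mul0r.
Qed.

End RL.

(** * Differentiation and injectivity *)

Section FTC.
Context {R : realType}.
Local Notation mu := (@lebesgue_measure R).

Lemma RLint1E (a t : R) (g : R -> R) :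
  RLint a 1 g t = \int[mu]_(s in `]a, t[) g s.
Proof.
rewrite /RLint oner_eq0 Gamma1 invr1 mul1r; apply: eq_Rintegral => s _.
by rewrite subrr powRr0 mul1r.
Qed.

(** Endpoints are negligible; the closed interval [x, t], which avoids the singularity at a, is the
    form used by the fundamental theorem. *)
Lemma RLint1B (a b sigma x t : R) (g : R -> R) : a < b -> sigma < 1 ->
  Cw a b sigma g -> a < x < t -> t <= b ->
  RLint a 1 g t - RLint a 1 g x = \int[mu]_(s in `[x, t]) g s.
Proof.
move=> ab s1 Cg /andP[ax xt] tb; have at_ := lt_trans ax xt.
have it : mu.-integrable `]a, t[ (EFin \o g).
  have tI : a < t <= b by rewrite at_.
  have := integrable_RL ab ltr01 s1 Cg tI.
  by apply: eq_integrable => // s _; rewrite /= subrr powRr0 mul1r.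
have iS (D : set R) : measurable D -> D `<=` `]a, t[%classic ->
    mu.-integrable D (EFin \o g).
  by move=> mD DS; exact: integrableS it.
have E1 : \int[mu]_(s in `]a, x[) g s = \int[mu]_(s in `]a, x]) g s.
  by apply: Rintegral_itv_bndo_bndc; apply: iS => //; apply: subset_itvl;
    rewrite bnd_simp ltW.
have E2 : \int[mu]_(s in `]a, t[) g s - \int[mu]_(s in `]a, x]) g s =
    \int[mu]_(s in `]x, t[) g s.
  by apply: (Rintegral_itvB it); rewrite bnd_simp// ltW.
have E3 : \int[mu]_(s in `]x, t[) g s = \int[mu]_(s in `[x, t[) g s.
  by apply: Rintegral_itv_obnd_cbnd; apply: iS => //; apply: subset_itvr;
    rewrite bnd_simp ltW.
have E4 : \int[mu]_(s in `[x, t[) g s = \int[mu]_(s in `[x, t]) g s.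
  by apply: Rintegral_itv_bndo_bndc; apply: iS => //; apply: subset_itvr;
    rewrite bnd_simp.
by rewrite !RLint1E E1 E2 E3 E4.
Qed.

Lemma RLint1_eq0 (a b sigma : R) (g : R -> R) : a < b -> sigma < 1 ->
  Cw a b sigma g -> (forall t, a < t <= b -> RLint a 1 g t = 0) ->
  forall t, a < t <= b -> g t = 0.
Proof.
move=> ab s1 Cg g0.
have gin t : a < t < b -> g t = 0.
  (* The primitive is based at a point strictly between a and t: g is continuous on [x, b] but
     possibly unbounded near a. *)
  move=> /andP[at_ tb]; pose x := (a + t) / 2.
  have [ax xt] : a < x /\ x < t by rewrite /x; split; lra.
  have xb : x < b by apply: lt_trans tb.
  have cg : {within `[x, b], continuous g} by exact: Cw_continuous Cg.
  have ig : mu.-integrable `[x, b] (EFin \o g).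
    by apply: continuous_compact_integrable => //; exact: segment_compact.
  have cgt : {for t, continuous g}.
    by apply: (within_continuous_continuous xb cg); rewrite in_itv/= xt.
  have [_ <-] := continuous_FTC1_closed tb ig xt cgt.
  rewrite derive1E (@near_eq_derive _ _ _ _ (cst 0)) ?derive_cst//.
  have : \forall y \near t, y \in `]x, b[.
    by apply: near_in_itvoo; rewrite in_itv/= xt.
  apply: filterS => y; rewrite in_itv/= => /andP[xy yb].
  by rewrite -(RLint1B ab s1 Cg) ?ax ?(ltW yb)// !g0 ?subrr ?ax
    ?(lt_trans ax) ?(ltW yb) ?(ltW xb).
(* At t = b there is no two-sided neighbourhood; the value comes from left continuity. *)
move=> t /andP[at_]; rewrite le_eqVlt => /predU1P[->|tb]; last first.
  by apply: gin; rewrite at_.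
have [h [ch _ gE]] := Cw_repr ab Cg.
have gb : (s - a) `^ (- sigma) * h s @[s --> b^'-] --> (b - a) `^ (- sigma) * h b.
  apply: cvg_at_left_filter; apply: cvgM; last exact: ch.
  exact: continuous_powRB.
have g0b : (s - a) `^ (- sigma) * h s @[s --> b^'-] --> 0.
  have : cst 0 s @[s --> b^'-] --> (0 : R) by exact: cvg_cst.
  apply: cvg_trans; apply: near_eq_cvg; near=> s.
  have sI : a < s < b.
    by apply/andP; split; near: s; [exact: nbhs_left_gt|exact: nbhs_left_lt].
  by rewrite /= -gE ?gin//; case/andP: sI => -> /ltW ->.
rewrite gE ?ab ?lexx//.
exact: (cvg_unique _ gb g0b).
Unshelve. all: by end_near. Qed.

(** Limits relative to (a, b] yield left limits at every point, b included; this also makes the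
    relative filter proper, hence its limits unique. *)
Lemma at_left_within (a b t : R) : a < t <= b ->
  t^'- `=>` within `]a, b] t^'.
Proof.
move=> /andP[at_ tb] P H.
have {}H : \forall x \near t, x != t -> `]a, b]%classic x -> P x := H.
change (\forall x \near t, x < t -> P x).
have A : \forall x \near t, a < x by exact: lt_nbhsr.
apply: filterS2 H A => x H ax xt; apply: H; first by rewrite lt_eqF.
by rewrite /= in_itv/= ax (le_trans (ltW xt) tb).
Qed.

Lemma diffquot_left (a b t l : R) (v : R -> R) : a < t <= b ->
  diffquot v t x @[x --> within `]a, b] t^'] --> l ->
  diffquot v t x @[x --> t^'-] --> l.
Proof.
by move=> tI; apply: cvg_trans; apply: cvg_app; exact: at_left_within.
Qed.

Lemma deriv_onE (a b t l : R) (v : R -> R) : a < t <= b ->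
  diffquot v t x @[x --> within `]a, b] t^'] --> l -> deriv_on a b v t = l.
Proof.
move=> tI vl; rewrite /deriv_on.
have PF : ProperFilter (within `]a, b] t^').
  apply: Build_ProperFilter_ex => P /(at_left_within tI) lP.
  by have [x] := filter_ex lP; exists x.
exact: cvg_lim.
Qed.

(** At an interior point the restriction to (a, b] is void nearby; what remains is the passage from
    x to the increment h = x - t. *)
Lemma diffquot_is_derive (a b t l : R) (v : R -> R) : a < t < b ->
  diffquot v t x @[x --> within `]a, b] t^'] --> l -> is_derive t 1 v l.
Proof.
move=> /andP[at_ tb] vl.
have H : h^-1 *: ((v \o shift t) (h *: 1) - v t) @[h --> 0^'] --> l.
  move=> P /vl {}H.
  have {}H : \forall x \near t, x != t -> `]a, b]%classic x -> P (diffquot v t x) := H.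
  change (\forall h \near 0, h != 0 -> P (h^-1 *: ((v \o shift t) (h *: 1) - v t))).
  have {}H : \forall h \near 0, h + t != t -> `]a, b]%classic (h + t) ->
      P (diffquot v t (h + t)).
    by move: H; rewrite (near_shift 0 t) subr0.
  have I : \forall h \near (0 : R), a < h + t < b.
    have : \forall x \near t, x \in `]a, b[.
      by apply: near_in_itvoo; rewrite in_itv/= at_.
    by rewrite (near_shift 0 t) subr0.
  apply: filterS2 H I => h H /andP[ah hb] h0.
  move: H; rewrite /diffquot addrK /= [h *: 1]mulr1 [_^-1 *: _]mulrC; apply.
    by rewrite -subr_eq0 addrK.
  by rewrite in_itv/= ah ltW.
apply: DeriveDef.
  by apply/cvg_ex; exists l.
exact: cvg_lim.
Qed.

(** Write v(x) = v(t) + q (x - t) with q the difference quotient. At t = b this evaluates the limit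
    in the boundary condition. *)
Lemma derivable_on_cvg_left (a b t : R) (v : R -> R) : a < t <= b ->
  derivable_on a b v -> v x @[x --> t^'-] --> v t.
Proof.
move=> tI /(_ t tI)[l /(diffquot_left tI) vl].
have xt : x - t @[x --> t^'-] --> t - t.
  by apply: cvgB; [apply: cvg_at_left_filter; exact: cvg_id|exact: cvg_cst].
have : v t + diffquot v t x * (x - t) @[x --> t^'-] --> v t + l * (t - t).
  by apply: cvgD; [exact: cvg_cst|exact: cvgM].
rewrite subrr mulr0 addr0.
apply: cvg_trans; apply: near_eq_cvg; near=> x.
have xt0 : x - t != 0 by rewrite subr_eq0 lt_eqF//; near: x; exact: nbhs_left_lt.
by rewrite /= /diffquot divfK// addrC subrK.
Unshelve. all: by end_near. Qed.

(** On [x, t] the classical theorem shows that I^1 v' - v takes the same value at x and t. As x ->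
    a+, I^1 v'(x) -> 0, since its weight sigma - 1 is negative, and v(x) -> [la]. *)
Lemma RLint_FTC (a b sigma la t : R) (v : R -> R) : a < b -> sigma < 1 ->
  derivable_on a b v -> Cw a b sigma (deriv_on a b v) ->
  v x @[x --> a^'+] --> la -> a < t <= b ->
  RLint a 1 (deriv_on a b v) t = v t - la.
Proof.
move=> ab s1 dv Cd vla tI; case/andP: (tI) => at_ tb.
set g := deriv_on a b v in Cd *.
have dvx x : a < x < b -> is_derive x 1 v (g x).
  move=> /andP[ax xb]; have xI : a < x <= b by rewrite ax ltW.
  have [l vl] := dv x xI; apply: (diffquot_is_derive (a := a) (b := b)).
    by rewrite ax.
  by rewrite /g (deriv_onE xI vl).
have cvx x : a < x < b -> {for x, continuous v}.
  move=> /dvx [vx _].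
  exact/differentiable_continuous/derivable1_diffP.
have incr x : a < x < t -> RLint a 1 g t - RLint a 1 g x = v t - v x.
  move=> /andP[ax xt]; rewrite (RLint1B ab s1 Cd) ?ax//.
  have xb : x < b by apply: lt_le_trans tb.
  rewrite /Rintegral (@continuous_FTC2 _ _ v)//.
  - apply: continuous_subspaceW (Cw_continuous ab ax Cd).
    by apply: subset_itvl; rewrite bnd_simp.
  - split => [y||].
    + rewrite in_itv/= => /andP[xy yt].
      have yI : a < y < b by rewrite (lt_trans ax)// (lt_le_trans yt).
      by have [] := dvx y yI.
    + by apply: cvg_at_right_filter; apply: cvx; rewrite ax.
    + exact: (derivable_on_cvg_left tI).
  - move=> y; rewrite in_itv/= => /andP[xy yt].
    have yI : a < y < b by rewrite (lt_trans ax)// (lt_le_trans yt).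
    by rewrite derive1E; have [_ ->] := dvx y yI.
have swap (p q r s : R) : p - q = r - s -> p - r = q - s by lra.
have RL0 : RLint a 1 g x @[x --> a^'+] --> 0.
  apply: (@Cw_cvg0 _ a b (sigma - 1)) => //; first by rewrite subr_lt0.
  exact: Cw_RLint.
have L1 : RLint a 1 g x - v x @[x --> a^'+] --> 0 - la by exact: cvgB.
have L2 : RLint a 1 g x - v x @[x --> a^'+] --> RLint a 1 g t - v t.
  have : cst (RLint a 1 g t - v t) x @[x --> a^'+] --> RLint a 1 g t - v t.
    exact: cvg_cst.
  apply: cvg_trans; apply: near_eq_cvg; near=> x.
  have xI : a < x < t.
    by apply/andP; split; near: x; [exact: nbhs_right_gt|exact: nbhs_right_lt].
  exact: swap (incr x xI).
have := cvg_unique _ L1 L2; rewrite sub0r => /(_ (@norm_hausdorff _ _)) E.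
by apply/eqP; rewrite -subr_eq0 opprB addrA addrAC -E addNr.
Unshelve. all: by end_near. Qed.

(** The bound m <= 1 allows I^(1-m) to be applied to I^m (g1 - g2) = 0, which leaves I^1 (g1 - g2) =
    0. *)
Lemma RLint_inj (a b sigma m : R) (g1 g2 : R -> R) : a < b -> 0 <= m <= 1 ->
  sigma < 1 -> Cw a b sigma g1 -> Cw a b sigma g2 ->
  (forall t, a < t <= b -> RLint a m g1 t = RLint a m g2 t) ->
  forall t, a < t <= b -> g1 t = g2 t.
Proof.
move=> ab /andP[m0 m1] s1 C1 C2 g12 t tI.
have Cg := Cw_lin (-1) ab C1 C2.
have : g1 t + -1 * g2 t = 0.
  apply: (RLint1_eq0 ab s1 Cg) tI => x xI.
  have := RLint_RLint ab _ m0 s1 Cg xI; rewrite -subr_ge0 in m1.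
  move=> /(_ _ m1); rewrite subrK => <-.
  rewrite -[RHS](RLint_cst0 a (1 - m) x); apply: (eq_RLint _ _ xI) => s sI.
  by rewrite (RLint_lin _ ab m0 s1 C1 C2 sI) g12//; ring.
by rewrite mulN1r => /eqP; rewrite subr_eq0 => /eqP.
Qed.

End FTC.
 

(** * The Hilfer equation *)

Section Kernel.
Context {R : realType}.

(** The homogeneous solution of D^gamma y = 0, normalised by I^(1-gamma) y = 1 when 0 < gamma <=
    1. *)
Definition powk (a gamma : R) (t : R) : R := (t - a) `^ (gamma - 1) / Gamma gamma.

Lemma Cw_powk (a b gamma : R) : Cw a b (1 - gamma) (powk a gamma).
Proof.
apply: (@Cw_of _ a b (1 - gamma) _ (fun=> (Gamma gamma)^-1)).
  exact: cst_continuous.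
by move=> t _; rewrite /powk opprB.
Qed.

Lemma RLint_powk (a gamma t : R) : 0 < gamma <= 1 -> a < t ->
  RLint a (1 - gamma) (powk a gamma) t = 1.
Proof.
move=> /andP[g0 g1] at_; rewrite /powk RLint_powR ?subr_ge0//.
by rewrite subrK subrr powRr0 Gamma1 divr1.
Qed.

Lemma RLint_neq0 (a m t : R) (g : R -> R) : m != 0 ->
  RLint a m g t = 1 / Gamma m *
    \int[@lebesgue_measure R]_(s in `]a, t[) ((t - s) `^ (m - 1) * g s).
Proof. by move=> m0; rewrite /RLint (negbTE m0) div1r. Qed.

End Kernel.

(** * The Hilfer equation in integral form, with initial constant A *)

Section HilferEquation.
Context {R : realType}.
Variables (a b alpha beta gamma : R) (z F : R -> R).
Hypothesis hab : a < b.
Hypothesis halpha : 0 < alpha < 1.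
Hypothesis hbeta : 0 <= beta <= 1.
Hypothesis hgamma : gamma = alpha + beta - alpha * beta.
Hypothesis CF : Cw a b (1 - gamma) F.
Hypothesis hz : Cwd a b gamma z.

Let delta := beta * (1 - alpha).
Let v := RLint a (1 - gamma) z.
Let phi := deriv_on a b v.

Let delta_ge0 : 0 <= delta.
Proof.
by case/andP: halpha => _ h1; case/andP: hbeta => h2 _; rewrite mulr_ge0// subr_ge0 ltW.
Qed.

Let gammaE : gamma = alpha + delta.
Proof. by rewrite hgamma /delta; ring. Qed.

Let alpha_gt0 : 0 < alpha. Proof. by case/andP: halpha. Qed.

Let gamma_gt0 : 0 < gamma. Proof. by rewrite gammaE ltr_wpDr. Qed.

Let gamma_le1 : gamma <= 1.
Proof.
have -> : gamma = 1 - (1 - beta) * (1 - alpha) by rewrite hgamma; ring.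
case/andP: halpha => _ h1; case/andP: hbeta => _ h2.
by rewrite gerBl mulr_ge0 ?subr_ge0// ltW.
Qed.

Let s1 : 1 - gamma < 1. Proof. by rewrite gtrBl. Qed.

Let g1 : 0 <= 1 - gamma. Proof. by rewrite subr_ge0. Qed.

Let delta_lt1 : delta < 1.
Proof. by rewrite (lt_le_trans _ gamma_le1)// gammaE ltrDr. Qed.

Let Cz : Cw a b (1 - gamma) z. Proof. by case: hz. Qed.
Let dv : derivable_on a b v. Proof. by case: hz. Qed.
Let Cphi : Cw a b (1 - gamma) phi. Proof. by case: hz. Qed.

Let HilferE t : Hilfer a b alpha beta z t = RLint a delta phi t.
Proof.
rewrite /Hilfer -/delta /phi /v; congr (RLint a _ (deriv_on a b (RLint a _ z)) t).
by rewrite hgamma; ring.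
Qed.

(** The gain of regularity is given up, so that all functions share the single weight 1 - gamma. *)
Let CwI (m : R) (g : R -> R) : 0 <= m -> Cw a b (1 - gamma) g ->
  Cw a b (1 - gamma) (RLint a m g).
Proof.
move=> m0 Cg; apply: (Cw_le hab _ (Cw_RLint hab m0 s1 Cg)).
by rewrite gerBl.
Qed.

Lemma RLint_sol (A : R) :
  (forall t, a < t <= b -> z t = RLint a alpha F t + A * powk a gamma t) ->
  forall t, a < t <= b -> v t = RLint a (1 - delta) F t + A.
Proof.
move=> zE t tI; rewrite /v (eq_RLint _ zE tI).
have a0 := ltW alpha_gt0.
have gaE : 1 - gamma + alpha = 1 - delta by rewrite gammaE; ring.
rewrite (RLint_lin _ hab g1 s1 (CwI a0 CF) (@Cw_powk R a b gamma) tI).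
rewrite (RLint_RLint hab g1 a0 s1 CF tI) RLint_powk ?gamma_gt0//;
    last by case/andP: tI.
by rewrite mulr1 gaE.
Qed.

(** I^(1-delta) F has weight (1 - gamma) - (1 - delta) = -alpha < 0 and so vanishes at a; only the
    constant survives. *)
Lemma RLint_sol_cvg (A : R) :
  (forall t, a < t <= b -> z t = RLint a alpha F t + A * powk a gamma t) ->
  v t @[t --> a^'+] --> A.
Proof.
move=> zE.
have d0 : 0 <= 1 - delta by rewrite subr_ge0 ltW.
have F0 : RLint a (1 - delta) F t @[t --> a^'+] --> 0.
  apply: (@Cw_cvg0 _ a b (1 - gamma - (1 - delta))) => //.
    have -> : 1 - gamma - (1 - delta) = - alpha by rewrite gammaE; ring.
    by rewrite oppr_lt0.
  exact: Cw_RLint.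
have : RLint a (1 - delta) F t + A @[t --> a^'+] --> 0 + A.
  by apply: cvgD => //; exact: cvg_cst.
rewrite add0r; apply: cvg_trans; apply: near_eq_cvg; near=> t.
rewrite /= (RLint_sol zE)//.
by apply/andP; split; near: t; [exact: nbhs_right_gt|exact: nbhs_right_le].
Unshelve. all: by end_near. Qed.

(** The hypothesis ties A to z, and both directions rest on I^1 phi = v - A. *)
Lemma Hilfer_sol (A : R) : v t @[t --> a^'+] --> A ->
  (forall t, a < t <= b -> Hilfer a b alpha beta z t = F t) <->
  (forall t, a < t <= b -> z t = RLint a alpha F t + A * powk a gamma t).
Proof.
move=> vA.
have FTC t : a < t <= b -> RLint a 1 phi t = v t - A.
  by move=> tI; exact: (RLint_FTC hab s1 dv Cphi vA tI).
have d0 : 0 <= 1 - delta by rewrite subr_ge0 ltW.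
have g0 := ltW gamma_gt0.
split=> H.
- have phiF t : a < t <= b -> RLint a gamma phi t = RLint a alpha F t.
    move=> tI; rewrite gammaE -(RLint_RLint hab (ltW alpha_gt0) delta_ge0 s1 Cphi tI).
    by apply: (eq_RLint _ _ tI) => s sI; rewrite -HilferE H.
  have C2 := Cw_lin A hab (CwI g0 Cphi) (@Cw_powk R a b gamma).
  have m01 : 0 <= 1 - gamma <= 1 by rewrite g1 ltW.
  move=> t tI; rewrite -phiF//.
  (* Under I^(1-gamma) the left side becomes v and the right side I^1 phi + A. *)
  apply: (RLint_inj hab m01 s1 Cz C2) tI => {}t tI.
  rewrite (RLint_lin _ hab g1 s1 (CwI g0 Cphi) (@Cw_powk R a b gamma) tI).
  rewrite (RLint_RLint hab g1 g0 s1 Cphi tI) RLint_powk ?gamma_gt0//;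
    last by case/andP: tI.
  by rewrite subrK FTC// mulr1 subrK.
- have d01 : 0 <= 1 - delta <= 1 by rewrite d0 gerBl.
  move=> t tI; rewrite HilferE.
  (* Under I^(1-delta) the left side becomes I^1 phi, and [RLint_sol] shows that the right side is v
     - A as well. *)
  apply: (RLint_inj hab d01 s1 (CwI delta_ge0 Cphi) CF) tI => {}t tI.
  by rewrite (RLint_RLint hab d0 delta_ge0 s1 Cphi tI) subrK FTC// (RLint_sol H)// addrK.
Qed.

End HilferEquation.

(** * The boundary value problem *)

Theorem lemma3p1 (R : realType) (a b alpha beta gamma c d ek : R)
    (f : R -> R -> R) (z : R -> R)
    (hab : a < b)
    (halpha : 0 < alpha < 1)
    (hbeta : 0 <= beta <= 1)
    (hgamma : gamma = alpha + beta - alpha * beta)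
    (hd : d != 0) (hcd : c + d != 0)
    (hf : forall y : R -> R,
        Cw a b (1 - gamma) y -> Cw a b (1 - gamma) (fun t => f t (y t)))
    (hz : Cwd a b gamma z) :
  ((forall t : R, a < t <= b -> Hilfer a b alpha beta z t = f t (z t)) /\
   boundary_condition a b gamma c d ek z)
  <->
  (forall t : R, a < t <= b ->
     z t =
       (t - a) `^ (gamma - 1) / Gamma gamma * (ek / (d * (1 + c / d)))
       - 1 / (1 + c / d) * ((t - a) `^ (gamma - 1) / Gamma gamma) *
         (1 / Gamma (1 - gamma + alpha) *
          \int[@lebesgue_measure R]_(s in `]a, b[)
             ((b - s) `^ (alpha - gamma) * f s (z s)))
       + 1 / Gamma alpha *
         \int[@lebesgue_measure R]_(s in `]a, t[)
            ((t - s) `^ (alpha - 1) * f s (z s))).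
Proof.
pose F t := f t (z t).
have Cz : Cw a b (1 - gamma) z by case: hz.
have CF : Cw a b (1 - gamma) F by exact: hf.
have a0 : 0 < alpha by case/andP: halpha.
have bI : a < b <= b by rewrite hab lexx.
pose J := RLint a (1 - beta * (1 - alpha)) F b.
(* The limits of I^(1-gamma) z at a and b are A and J + A, so this A solves c A + d (J + A) =
   [ek]. *)
pose A := (ek - d * J) / (c + d).
have gE : 1 - gamma + alpha = 1 - beta * (1 - alpha) by rewrite hgamma; ring.
have g'0 : 0 < 1 - beta * (1 - alpha).
  rewrite subr_gt0; case/andP: halpha => _ h1; case/andP: hbeta => h2 h3.
  by rewrite (le_lt_trans (ler_piMl _ h3))// ?subr_ge0 ?ltW// gtrBl.
set zform := (X in _ <-> X).
have zP : zform <->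
    (forall t, a < t <= b -> z t = RLint a alpha F t + A * powk a gamma t).
  have cd0 : 1 + c / d != 0.
    by have -> : 1 + c / d = (c + d) / d; [field|rewrite mulf_neq0 ?invr_eq0].
  have JE : 1 / Gamma (1 - gamma + alpha) *
      \int[@lebesgue_measure R]_(s in `]a, b[)
        ((b - s) `^ (alpha - gamma) * f s (z s)) = J.
    rewrite /J (RLint_neq0 _ _ _ (lt0r_neq0 g'0)) gE; congr (_ * _).
    by apply: eq_Rintegral => s _; congr (_ `^ _ * _); rewrite hgamma; ring.
  (* Here p stands for the kernel [powk], q for I^alpha F and j for J; d (1 + c/d) = c + d collects
     the first two terms into A p. *)
  have alg (p q j : R) : p * (ek / (d * (1 + c / d))) -
      1 / (1 + c / d) * p * j + q = q + (ek - d * j) / (c + d) * p.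
    by field; rewrite hd hcd.
  have E t : (t - a) `^ (gamma - 1) / Gamma gamma * (ek / (d * (1 + c / d)))
      - 1 / (1 + c / d) * ((t - a) `^ (gamma - 1) / Gamma gamma) *
        (1 / Gamma (1 - gamma + alpha) *
         \int[@lebesgue_measure R]_(s in `]a, b[)
            ((b - s) `^ (alpha - gamma) * f s (z s)))
      + 1 / Gamma alpha *
        \int[@lebesgue_measure R]_(s in `]a, t[)
           ((t - s) `^ (alpha - 1) * f s (z s)) =
      RLint a alpha F t + A * powk a gamma t.
    rewrite -alg; congr (_ - _ * _ + _); first exact: JE.
    exact/esym/RLint_neq0/lt0r_neq0.
  by split=> H t tI; have := H t tI; rewrite E.
apply: iff_trans (iff_sym zP).
have dv : derivable_on a b (RLint a (1 - gamma) z) by case: hz.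
(* The limit at b in the boundary condition is therefore the value of I^(1-gamma) z at b. *)
have vb := derivable_on_cvg_left bI dv.
split.
- move=> [H [la [lb [vla vlb e]]]].
  have zE := (Hilfer_sol hab halpha hbeta hgamma CF hz vla).1 H.
  have lbE : lb = J + la.
    rewrite -(RLint_sol hab halpha hbeta hgamma CF zE bI).
    exact: (cvg_unique _ vlb vb).
  (* With [lb] = J + [la], the boundary condition is a linear equation for [la], solvable since c +
     d is nonzero. *)
  suff <- : la = A by [].
  by rewrite /A -e lbE; field.
- move=> zE.
  have vA := RLint_sol_cvg hab halpha hbeta hgamma CF zE.
  split; first exact/(Hilfer_sol hab halpha hbeta hgamma CF hz vA).
  exists A, (J + A); split => //.
    by rewrite -(RLint_sol hab halpha hbeta hgamma CF zE bI).
  by rewrite /A; field.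
Qed.
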